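(* Fix $0<p<1$ and set $N=p/(1-p)$. With all operators on $\mathcal H_j$ transported to the Fock space via $W_j$ (i.e. $X\mapsto W_jXW_j^*$), the following hold as $j\to\infty$ through the half-integers: (1) $\rho_{j,p}\to\rho_{0,N}$ in trace norm; (2) for every fixed $z\in\mathbb{C}$, $|j,\tfrac{z}{\sqrt{2j}})(j,\tfrac{z}{\sqrt{2j}}|\to|z)(z|$ in trace norm; (3) $\mathrm{Tr}\,\rho_{j,p}(a-\tfrac{1}{\sqrt{2j}}J_{j,+})^*(a-\tfrac{1}{\sqrt{2j}}J_{j,+})\to0$ and $\mathrm{Tr}\,\rho_{j,p}(a^*-\tfrac{1}{\sqrt{2j}}J_{j,-})^*(a^*-\tfrac{1}{\sqrt{2j}}J_{j,-})\to0$; (4) $\mathrm{Tr}\,\rho_{j,p}(Q-\tfrac1{\sqrt j}J_{j,1})^2\to0$ and $\mathrm{Tr}\,\rho_{j,p}(P-\tfrac1{\sqrt j}J_{j,2})^2\to0$; (5) $\mathrm{Tr}\,\rho_{j,p}Q^2\to\mathrm{Tr}\,\rho_{0,N}Q^2$, $\mathrm{Tr}\,\rho_{j,p}P^2\to\mathrm{Tr}\,\rho_{0,N}P^2$, $\mathrm{Tr}\,\rho_{j,p}(Q\circ P)\to\mathrm{Tr}\,\rho_{0,N}(Q\circ P)$; (6) $\mathrm{Tr}\,\rho_{j,p}\big((Q-\tfrac1{\sqrt j}J_{j,1})\circ Y\big)\to0$ and $\mathrm{Tr}\,\rho_{j,p}\big((P-\tfrac1{\sqrt j}J_{j,2})\circ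 Y\big)\to0$ for $Y\in\{Q,P\}$.
   Context: For a half-integer $j\ge0$, $\mathcal H_j$ is the spin-$j$ representation space of $\mathfrak{su}(2)$ with orthonormal basis $|j,m\rangle$, $m=j,j-1,\dots,-j$, and generators $J_{j,1},J_{j,2},J_{j,3}$ with $J_{j,3}|j,m\rangle=m|j,m\rangle$, $J_{j,\pm}=J_{j,1}\pm iJ_{j,2}$, $J_{j,+}|j,m\rangle=\sqrt{(j-m)(j+m+1)}|j,m+1\rangle$, $J_{j,-}|j,m\rangle=\sqrt{(j-m+1)(j+m)}|j,m-1\rangle$. Fock space: $\ell^2$ with number basis $|n\rangle$, $n\ge0$; $a|n\rangle=\sqrt n|n-1\rangle$, $Q=(a+a^* )/\sqrt2$, $P=(a-a^* )/(i\sqrt2)$, $X\circ Y=(XY+YX)/2$. The isometry $W_j:\mathcal H_j\to\ell^2$ is $W_j|j,m\rangle=|j-m\rangle$. Coherent vector: $|z)=e^{-|z|^2/2}\sum_{n\ge0}\frac{z^n}{\sqrt{n!}}|n\rangle$. Thermal state: $\rho_{0,N}=\frac1{N+1}\sum_{n\ge0}(\frac{N}{N+1})^n|n\rangle\langle n|$. Spin state: $\rho_{j,p}=\frac{1-p}{1-p^{2j+1}}\sum_{m=-j}^jp^{j-m}|j,m\rangle\langle j,m|$. Spin coherent vector for $|z|\le1$: $|j,z)=\sum_{m=-j}^j\sqrt{\binom{2j}{j+m}}\,z^{j-m}(1-|z|^2)^{(j+m)/2}|j,m\rangle$. *)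

(* Defs.v *)
From HB Require Import structures.
From mathcomp Require Import all_boot all_order all_algebra.
From mathcomp Require Import all_classical all_reals all_analysis.
From mathcomp Require Export complex.
Import Order.TTheory GRing.Theory Num.Theory numFieldNormedType.Exports.

Set Implicit Arguments.
Unset Strict Implicit.
Unset Printing Implicit Defensive.

Local Open Scope ring_scope.
Local Open Scope classical_set_scope.

(* The complex numbers R[i] (a numClosedFieldType) get their standard
   (norm-induced) topology, so that limits of complex sequences make sense. *)
HB.instance Definition _ (R : realType) := PseudoPointedMetric.copy R[i] (R[i])^o.

Section QuantumDefs.
Variable R : realType.
Local Notation C := R[i].

Definition rc (x : R) : C := Complex x 0.
Definition cabs (x : C) : R := Num.sqrt (complex.Re x ^+ 2 + complex.Im x ^+ 2).
Definition iC : C := Complex 0 1.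

(* Operators on the Fock space l^2, given by their matrix elements in the   *)
(* number basis:  X m n = <m| X |n>.                                        *)
Definition op := nat -> nat -> C.

Definition opadd (X Y : op) : op := fun m n => X m n + Y m n.
Definition opsub (X Y : op) : op := fun m n => X m n - Y m n.
Definition opscale (c : C) (X : op) : op := fun m n => c * X m n.
Definition opmul (X Y : op) : op :=
  fun m n => lim (series (fun k => X m k * Y k n) @ \oo).
Definition adj (X : op) : op := fun m n => conjc (X n m).
Definition jordan (X Y : op) : op :=
  opscale (rc (1 / 2)) (opadd (opmul X Y) (opmul Y X)).
Definition trace (X : op) : C := lim (series (fun m => X m m) @ \oo).

(* Trace norm:  ||X||_1 = sup sum_i |<f_i, X e_i>| over pairs of finite
   orthonormal families (e_i), (f_i) of finitely supported vectors
   (supported in span{|0>,...,|K-1>}).  The rows of U (resp. V) are the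
   f_i (resp. e_i). *)
Definition trunc (K : nat) (X : op) : 'M[C]_K := \matrix_(m < K, n < K) X m n.
Definition cadjmx (r K : nat) (U : 'M[C]_(r, K)) : 'M[C]_(K, r) :=
  map_mx conjc U^T.
Definition trace_norm (X : op) : \bar R :=
  ereal_sup [set x : \bar R | exists (K r : nat) (U V : 'M[C]_(r, K)),
     [/\ U *m cadjmx U = 1%:M, V *m cadjmx V = 1%:M &
         x = (\sum_(i < r) cabs ((map_mx conjc U *m trunc K X *m V^T) i i))%:E]].

Definition ketbra (u : nat -> C) : op := fun m n => u m * conjc (u n).

Definition ann : op := fun m n => if n == m.+1 then rc (Num.sqrt n%:R) else 0.
Definition cre : op := adj ann.
Definition Qop : op := opscale (rc (1 / Num.sqrt 2)) (opadd ann cre).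
Definition Pop : op := opscale ((iC * rc (Num.sqrt 2))^-1) (opsub ann cre).

Definition coh (z : C) : nat -> C :=
  fun n => rc (expR (- (cabs z ^+ 2) / 2)) * z ^+ n / rc (Num.sqrt (factorial n)%:R).

Definition thermal (N : R) : op :=
  fun m n => if m == n then rc (1 / (N + 1) * (N / (N + 1)) ^+ m) else 0.

(* Spin-j representation, j = n2/2 with n2 : nat.  H_j has the orthonormal *)
(* basis |j,m_i>, i : 'I_(n2+1), where m_i = j - i runs over j, j-1,...,-j. *)
(* Operators on H_j are matrices in this basis.                            *)
Definition jval (n2 : nat) : R := n2%:R / 2.
Definition mval (n2 : nat) (i : 'I_n2.+1) : R := jval n2 - i%:R.

Definition Jplus (n2 : nat) : 'M[C]_n2.+1 :=
  \matrix_(i, k) if mval i == mval k + 1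
     then rc (Num.sqrt ((jval n2 - mval k) * (jval n2 + mval k + 1))) else 0.
Definition Jminus (n2 : nat) : 'M[C]_n2.+1 :=
  \matrix_(i, k) if mval i == mval k - 1
     then rc (Num.sqrt ((jval n2 - mval k + 1) * (jval n2 + mval k))) else 0.
Definition J1 (n2 : nat) : 'M[C]_n2.+1 := (rc (1 / 2)) *: (Jplus n2 + Jminus n2).
Definition J2 (n2 : nat) : 'M[C]_n2.+1 :=
  ((rc 2 * iC)^-1) *: (Jplus n2 - Jminus n2).

(* spin state rho_{j,p}; note j - m_i = i *)
Definition spin_state (p : R) (n2 : nat) : 'M[C]_n2.+1 :=
  \matrix_(i, k) if i == k
     then rc ((1 - p) / (1 - p ^+ n2.+1) * p ^+ i) else 0.

(* spin coherent vector |j,w):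
   coefficient of |j,m> is sqrt(binom(2j, j+m)) w^(j-m) (1-|w|^2)^((j+m)/2),
   with j + m_i = n2 - i and j - m_i = i. *)
Definition spin_coh (n2 : nat) (w : C) : 'I_n2.+1 -> C :=
  fun i => rc (Num.sqrt ('C(n2, n2 - i))%:R) * w ^+ i
           * rc ((1 - cabs w ^+ 2) `^ ((n2 - i)%:R / 2)).
Definition spin_ketbra (n2 : nat) (v : 'I_n2.+1 -> C) : 'M[C]_n2.+1 :=
  \matrix_(i, k) (v i * conjc (v k)).

(* the isometry W_j : H_j -> l^2,  W_j |j,m> = |j - m>, as matrix elements
   <r| W_j |j,m_i> *)
Definition Wj (n2 : nat) (r : nat) (i : 'I_n2.+1) : C :=
  if r%:R == jval n2 - mval i then 1 else 0.
Definition transport (n2 : nat) (X : 'M[C]_n2.+1) : op :=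
  fun r s => \sum_(i < n2.+1) \sum_(k < n2.+1) Wj r i * X i k * conjc (Wj s k).

End QuantumDefs.

Arguments spin_coh {R} n2 w i.

(* Main.v *)
(** In the number basis every operator involved is diagonal or has its only
    nonzero entries next to the diagonal: [a] is the lowering operator with
    weights [sqrt (k+1)], and [a - J_+ / sqrt (2j)] the one with weights
    [sqrt (k+1) * (1 - sqrt (1 - k / 2j))], which lie between [0] and
    [sqrt (k+1)] and tend to [0] for each [k].  Each trace in (3)-(6) is thus
    a series dominated by [(k+1) p^k] up to a constant, and dominated
    convergence applies; it also gives (1), since the trace norm of a diagonal
    operator is at most the [l^1] norm of its diagonal.  For (2), the squared
    coefficients of the spin coherent vector are dominated by [|z|^(2k) / k!],
    so these vectors converge in [l^2], and the trace norm of a difference of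
    rank-one operators is controlled by the [l^2] distance. *)

Require Import Defs.
From HB Require Import structures.
From mathcomp Require Import all_boot all_order all_algebra.
From mathcomp Require Import all_classical all_reals all_analysis.
From mathcomp Require Import complex.
From mathcomp Require Import ring lra.
Import Order.TTheory GRing.Theory Num.Theory numFieldNormedType.Exports.
Local Open Scope ring_scope.
Local Open Scope classical_set_scope.

Set Implicit Arguments.
Unset Strict Implicit.
Unset Printing Implicit Defensive.

(** * Real numbers inside the complex numbers, moduli, and limits of complex sequences *)

Section ComplexLimits.
Variable R : realType.
Implicit Types (x y : R) (z w : R[i]).

Lemma rcE x : rc x = x%:C%C. Proof. by []. Qed.

Lemma rcI : injective (@rc R). Proof. exact: complexI. Qed.

Lemma rc0 : rc 0 = 0 :> R[i]. Proof. by []. Qed.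

Lemma rc1 : rc 1 = 1 :> R[i]. Proof. by []. Qed.

Lemma rcN x : rc (- x) = - rc x.
Proof. by rewrite !rcE rmorphN. Qed.

Lemma rcD x y : rc (x + y) = rc x + rc y.
Proof. by rewrite !rcE rmorphD. Qed.

Lemma rcB x y : rc (x - y) = rc x - rc y.
Proof. by rewrite !rcE rmorphB. Qed.

Lemma rcM x y : rc (x * y) = rc x * rc y.
Proof. by rewrite !rcE rmorphM. Qed.

Lemma rcV x : rc x^-1 = (rc x)^-1.
Proof. by rewrite !rcE fmorphV. Qed.

Lemma rcX x n : rc (x ^+ n) = rc x ^+ n.
Proof. by rewrite !rcE rmorphXn. Qed.

Lemma rc_sum I (s : seq I) (f : I -> R) :
  rc (\sum_(i <- s) f i) = \sum_(i <- s) rc (f i).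
Proof. by rewrite rcE rmorph_sum. Qed.

Definition csq z : R := complex.Re z ^+ 2 + complex.Im z ^+ 2.

Lemma csq_ge0 z : 0 <= csq z.
Proof. by rewrite addr_ge0 ?sqr_ge0. Qed.

Lemma cabs_sqr z : cabs z ^+ 2 = csq z.
Proof. by rewrite sqr_sqrtr ?csq_ge0. Qed.

Lemma cabs_ge0 z : 0 <= cabs z.
Proof. exact: sqrtr_ge0. Qed.

Lemma rc_cabs z : rc (cabs z) = `|z|.
Proof. by rewrite normc_def rcE; case: z. Qed.

Lemma rc_csq z : rc (csq z) = z * conjc z.
Proof. by rewrite -cabs_sqr rcX rc_cabs sqr_normc. Qed.

Lemma cabsM z w : cabs (z * w) = cabs z * cabs w.
Proof. by apply: rcI; rewrite rcM !rc_cabs normrM. Qed.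

Lemma cabsD z w : cabs (z + w) <= cabs z + cabs w.
Proof. by rewrite -lecR -!rcE rcD !rc_cabs ler_normD. Qed.

Lemma cabs_sum K (f : 'I_K -> R[i]) : cabs (\sum_i f i) <= \sum_i cabs (f i).
Proof.
rewrite -lecR rmorph_sum /= -rcE rc_cabs (le_trans (ler_norm_sum _ _ _))//.
by rewrite le_eqVlt; apply/orP; left; apply/eqP/eq_bigr => i _; rewrite -rc_cabs.
Qed.

Lemma cabs_rc x : cabs (rc x) = `|x|.
Proof. by rewrite /cabs /= expr0n addr0 sqrtr_sqr. Qed.

Lemma cabs_conjc z : cabs (conjc z) = cabs z.
Proof. by case: z => a b; rewrite /cabs /= sqrrN. Qed.

Lemma csqM z w : csq (z * w) = csq z * csq w.
Proof. by rewrite -!cabs_sqr cabsM exprMn. Qed.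

Lemma csq_rc x : csq (rc x) = x ^+ 2.
Proof. by rewrite -cabs_sqr cabs_rc real_normK ?num_real. Qed.

Lemma csqX z n : csq (z ^+ n) = csq z ^+ n.
Proof.
elim: n => [|n IH]; first by rewrite !expr0 -rc1 csq_rc expr1n.
by rewrite !exprS csqM IH.
Qed.

Lemma rc_cvg (u : nat -> R) x :
  u @ \oo --> x -> (fun n => rc (u n)) @ \oo --> rc x.
Proof.
move=> /cvgrPdist_lt ux; apply/(@cvgrPdist_lt _ (R[i]^o)) => /= e e0.
(* In the order of [R[i]] a positive element has zero imaginary part, so the complex radius [e] is a
   real one. *)
have [e1 e2] : 0 < complex.Re e /\ e = rc (complex.Re e).
  by case: e e0 => a b; rewrite ltcE /= => /andP[/eqP -> a0].
near=> n; rewrite e2 -rcB -rc_cabs cabs_rc rcE ltcR.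
by near: n; exact: ux.
Unshelve. all: by end_near. Qed.

Lemma lim_complex (u : nat -> R[i]) z : u @ \oo --> z -> lim (u @ \oo) = z.
Proof. by apply/cvg_lim; apply: (@norm_hausdorff _ (R[i]^o)). Qed.

(** Operator products and traces are defined as limits of series; for band operators and for states
    on a finite-dimensional space only finitely many terms survive, and the limit becomes a finite
    sum. *)
Lemma series_finite_cvg (u : nat -> R[i]) K :
  (forall k, (K <= k)%N -> u k = 0) ->
  lim (series u @ \oo) = \sum_(0 <= k < K) u k.
Proof.
move=> u0; apply: lim_complex; apply: cvg_near_cst; near=> n.
rewrite /series /= (@big_cat_nat _ _ _ K)//=; last by near: n; exact: nbhs_infty_ge.
by rewrite [X in _ + X]big_nat_cond [X in _ + X]big1 ?addr0// => k /andP[/andP[/u0]].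
Unshelve. all: by end_near. Qed.

End ComplexLimits.

(** * Dominated convergence for series *)

Section Tannery.
Variable R : realType.

(** Tannery's theorem: beyond a fixed [M] the sum is at most a tail of [g], below [M] finitely many
    terms tend to 0. The conclusion is uniform in [K], which suits the trace norm, a supremum over
    truncations. *)
Lemma tannery0 (f : nat -> nat -> R) (g : nat -> R) :
  (\forall n \near \oo, forall k, 0 <= f n k <= g k) ->
  cvgn (series g) ->
  (forall k, f ^~ k @ \oo --> 0) ->
  forall e : R, 0 < e ->
  \forall n \near \oo, forall K, \sum_(0 <= k < K) f n k <= e.
Proof.
move=> fg cg f0 e e0.
have e20 : 0 < e / 2 by rewrite divr_gt0.
have /cvgrPdist_le /(_ _ e20) [M _ HM] := cg.
have g0 k : 0 <= g k.
  have [n _ Hn] := fg.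
  by have /andP[] := Hn n (leqnn n) k; exact: le_trans.
have tail K : (M <= K)%N -> \sum_(M <= k < K) g k <= e / 2.
  move=> MK; have := HM M (leqnn M).
  have cl : series g K <= limn (series g).
    apply: nondecreasing_cvgn_le => //.
    by apply/nondecreasing_seqP => n; rewrite /series /= big_nat_recr//= lerDl.
  apply: le_trans; apply: le_trans (ler_norm _).
  rewrite lerBrDr addrC (le_trans _ cl)// /series /= [leRHS](@big_cat_nat _ _ _ M)//=.
have s0 : (fun n => \sum_(0 <= k < M) f n k) @ \oo --> 0.
  elim: (M) => [|m IH].
    by under eq_fun do rewrite big_nil; exact: cvg_cst.
  under eq_fun do rewrite big_nat_recr//=.
  by have := cvgD IH (f0 m); rewrite addr0; exact.
have /cvgrPdist_le /(_ _ e20) s0' := s0.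
near=> n => K.
have fgn : forall k, 0 <= f n k <= g k by near: n.
have sn : \sum_(0 <= k < M) f n k <= e / 2.
  have : `|0 - \sum_(0 <= k < M) f n k| <= e / 2 by near: n.
  by rewrite sub0r normrN; apply: le_trans; exact: ler_norm.
have [KM|MK] := leqP K M.
  apply: le_trans (le_trans sn _); last by lra.
  rewrite (@big_cat_nat _ _ _ K 0 M)//= lerDl sumr_ge0// => k _.
  by have /andP[] := fgn k.
rewrite (@big_cat_nat _ _ _ M)//= ?(ltnW MK)//.
rewrite [e in _ <= e](splitr e) lerD//.
apply: le_trans (tail K (ltnW MK)); apply: ler_sum => k _.
by have /andP[] := fgn k.
Unshelve. all: by end_near. Qed.

(** The partial sums increase and stay below [(1 - p)^-2], by a closed form proved by induction. *)
Lemma cvg_series_arith_geometric (p : R) : 0 < p -> p < 1 ->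
  cvgn (series (fun k => k.+1%:R * p ^+ k)).
Proof.
move=> p0 p1; apply: nondecreasing_is_cvgn.
  apply/nondecreasing_seqP => n; rewrite /series /= big_nat_recr//= lerDl.
  by rewrite mulr_ge0// exprn_ge0// ltW.
exists ((1 - p) ^- 2) => _ [n _ <-].
have p10 : 0 < (1 - p) ^+ 2 by rewrite exprn_gt0// subr_gt0.
rewrite -[leRHS]mul1r ler_pdivlMr//.
have -> : series (fun k => k.+1%:R * p ^+ k) n * (1 - p) ^+ 2 =
    1 - p ^+ n * (n%:R * (1 - p) + 1).
  elim: n => [|n IH]; first by rewrite /series /= big_nil !mul0r mul1r add0r subrr.
  rewrite /series /= big_nat_recr//= mulrDl.
  move: IH; rewrite /series /= => ->; rewrite (exprS p n) -natr1; ring.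
rewrite gerBl mulr_ge0 ?exprn_ge0 ?(ltW p0)//.
by rewrite addr_ge0// mulr_ge0// subr_ge0 ltW.
Qed.

End Tannery.

(** * Bessel's inequality and upper bounds for the trace norm *)

Section TraceNorm.
Variable R : realType.
Local Notation C := R[i].

Lemma cadjmxM m n q (A : 'M[C]_(m, n)) (B : 'M[C]_(n, q)) :
  cadjmx (A *m B) = cadjmx B *m cadjmx A.
Proof. by rewrite /cadjmx trmx_mul map_mxM. Qed.

Lemma cadjmxB m n (A B : 'M[C]_(m, n)) : cadjmx (A - B) = cadjmx A - cadjmx B.
Proof. by rewrite /cadjmx linearB /= map_mxB. Qed.

Lemma cadjmxK m n (A : 'M[C]_(m, n)) : cadjmx (cadjmx A) = A.
Proof. by apply/matrixP => i j; rewrite !mxE conjcK. Qed.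

(** The trace norm has [conj U] on the left and [V^T], the adjoint of [conj V], on the right, so
    Bessel's inequality has to be applied to the conjugated families. *)
Lemma map_conjc_isometry r K (U : 'M[C]_(r, K)) : U *m cadjmx U = 1%:M ->
  map_mx conjc U *m cadjmx (map_mx conjc U) = 1%:M.
Proof.
move=> /(congr1 (map_mx conjc)); rewrite map_mx1 map_mxM => <-.
by congr (_ *m _); apply/matrixP => i j; rewrite !mxE.
Qed.

Definition vsq K (v : 'cV[C]_K) : R := \sum_k csq (v k 0).

Lemma vsq_ge0 K (v : 'cV[C]_K) : 0 <= vsq v.
Proof. by apply: sumr_ge0 => k _; exact: csq_ge0. Qed.

Lemma rc_vsq K (v : 'cV[C]_K) : rc (vsq v) = (cadjmx v *m v) 0 0.
Proof.
rewrite mxE rc_sum; apply: eq_bigr => k _.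
by rewrite rc_csq !mxE mulrC.
Qed.

(* [1 - B^* B] is an orthogonal projection. *)
Lemma bessel r K (B : 'M[C]_(r, K)) (u : 'cV[C]_K) :
  B *m cadjmx B = 1%:M -> vsq (B *m u) <= vsq u.
Proof.
move=> BB; rewrite -subr_ge0.
suff -> : vsq u - vsq (B *m u) = vsq (u - cadjmx B *m (B *m u)) by exact: vsq_ge0.
apply: rcI; rewrite rcB !rc_vsq.
rewrite cadjmxB !cadjmxM cadjmxK mulmxBl !mulmxBr.
have -> : cadjmx u *m cadjmx B *m B *m (cadjmx B *m (B *m u)) =
    cadjmx u *m cadjmx B *m (B *m u).
  by rewrite -!mulmxA (mulmxA B (cadjmx B)) BB mul1mx.
by rewrite -!mulmxA subrr subr0 !mxE.
Qed.

(** Bessel's inequality at the [k]-th basis vector, whose image under [B] is the [k]-th column. *)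
Lemma bessel_col r K (B : 'M[C]_(r, K)) (k : 'I_K) :
  B *m cadjmx B = 1%:M -> \sum_i csq (B i k) <= 1.
Proof.
move=> /(bessel (delta_mx k 0)); rewrite -colE => h.
have <- : vsq (delta_mx k 0 : 'cV[C]_K) = 1.
  rewrite /vsq (bigD1 k)//= big1 ?addr0.
    by rewrite mxE !eqxx /= -rc1 csq_rc expr1n.
  move=> i /negbTE ik; by rewrite mxE ik mulr0n -rc0 csq_rc expr0n.
by apply: le_trans h; apply: ler_sum => i _; rewrite mxE.
Qed.

Lemma trace_norm_ge0 (X : op R) : (0%:E <= trace_norm X)%E.
Proof.
apply: ereal_sup_ubound; exists 0%N, 0%N, 0, 0.
by split; [apply/matrixP; case|apply/matrixP; case|rewrite big_ord0].
Qed.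

(** The arithmetic-geometric mean inequality gives [|U_ik| |V_ik| <= (|U_ik|^2 + |V_ik|^2) / 2].
    Summing over [i] first, the column form of Bessel's inequality leaves a factor at most 1 on each
    [|X_kk|]. *)
Lemma trace_norm_diag_le (X : op R) (e : R) :
  (forall m n, m != n -> X m n = 0) ->
  (forall K, \sum_(0 <= k < K) cabs (X k k) <= e) ->
  (trace_norm X <= e%:E)%E.
Proof.
move=> X0 Xe; apply: ge_ereal_sup => _ [K [r [U [V [UU VV ->]]]]].
rewrite lee_fin; apply: le_trans (Xe K); rewrite big_mkord.
have H i : cabs ((map_mx conjc U *m trunc K X *m V^T) i i) <=
    \sum_(k < K) cabs (X k k) * ((csq (U i k) + csq (V i k)) / 2).
  rewrite mxE; apply: le_trans (cabs_sum _) _; apply: ler_sum => k _.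
  have -> : (map_mx conjc U *m trunc K X) i k = conjc (U i k) * X k k.
    rewrite mxE (bigD1 k)//= big1 ?addr0 ?mxE// => l lk.
    by rewrite !mxE X0 ?mulr0.
  rewrite !mxE !cabsM cabs_conjc mulrAC mulrC ler_wpM2l ?cabs_ge0//.
  rewrite -!cabs_sqr ler_pdivlMr//.
  by have := sqr_ge0 (cabs (U i k) - cabs (V i k)); nra.
apply: le_trans (ler_sum _ (fun i _ => H i)) _.
rewrite exchange_big /=; apply: ler_sum => k _.
rewrite -mulr_sumr ler_piMr ?cabs_ge0// -mulr_suml big_split /=.
by have := bessel_col k UU; have := bessel_col k VV; lra.
Qed.

(** Expand [(t x - y)^2 >= 0]. The weight [t] balances a bounded factor [x] against a small factor
    [y], and so stands in for Cauchy-Schwarz. *)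
Lemma amgm_scaled (t x y : R) : 0 < t -> x * y <= (t * x ^+ 2 + y ^+ 2 / t) / 2.
Proof.
move=> t0; rewrite ler_pdivlMr// -(ler_pM2l t0) [leRHS]mulrDr.
have -> : t * (y ^+ 2 / t) = y ^+ 2 by rewrite mulrCA divff ?gt_eqF// mulr1.
by have := sqr_ge0 (t * x - y); nra.
Qed.

(** With [w = u - v], the difference is [|u)(w| + |w)(v|]. Each diagonal entry of a rank-one term is
    a product of two inner products; the weighted mean inequality with [t = e], then Bessel, bounds
    each of the two sums by [(e M + e^2 / e) / 2]. *)
Lemma trace_norm_ketbra_sub_le (u v : nat -> C) (M e : R) : 0 < e ->
  (forall K, \sum_(0 <= k < K) csq (u k) <= M) ->
  (forall K, \sum_(0 <= k < K) csq (v k) <= M) ->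
  (forall K, \sum_(0 <= k < K) csq (u k - v k) <= e ^+ 2) ->
  (trace_norm (opsub (ketbra u) (ketbra v)) <= (e * (M + 1))%:E)%E.
Proof.
move=> e0 uM vM uve; apply: ge_ereal_sup => _ [K [r [U [V [UU VV ->]]]]].
pose cu : 'cV[C]_K := \col_k u k; pose cv : 'cV[C]_K := \col_k v k.
pose cw : 'cV[C]_K := cu - cv.
have cuM : vsq cu <= M.
  by apply: le_trans (uM K); rewrite big_mkord; apply: ler_sum => k _; rewrite mxE.
have cvM : vsq cv <= M.
  by apply: le_trans (vM K); rewrite big_mkord; apply: ler_sum => k _; rewrite mxE.
have cwe : vsq cw <= e ^+ 2.
  by apply: le_trans (uve K); rewrite big_mkord; apply: ler_sum => k _; rewrite !mxE.
have trE : trunc K (opsub (ketbra u) (ketbra v)) =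
    cu *m cadjmx cw + cw *m cadjmx cv.
  apply/matrixP => i j; rewrite !mxE !big_ord1 !mxE /opsub /ketbra rmorphB /=.
  by ring.
set Ub := map_mx conjc U; set Vb := map_mx conjc V.
have UbUb : Ub *m cadjmx Ub = 1%:M by exact: map_conjc_isometry.
have VbVb : Vb *m cadjmx Vb = 1%:M by exact: map_conjc_isometry.
have rank1 (x y : 'cV[C]_K) i : (Ub *m (x *m cadjmx y) *m V^T) i i =
    (Ub *m x) i 0 * conjc ((Vb *m y) i 0).
  rewrite mulmxA -mulmxA mxE big_ord1; congr (_ * _).
  have -> : cadjmx y *m V^T = cadjmx (Vb *m y).
    rewrite cadjmxM; congr (_ *m _); apply/matrixP => a b.
    by rewrite !mxE conjcK.
  by rewrite !mxE.
rewrite lee_fin trE.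
pose a i := csq ((Ub *m cu) i 0); pose b i := csq ((Vb *m cw) i 0).
pose c i := csq ((Ub *m cw) i 0); pose d i := csq ((Vb *m cv) i 0).
have H i : cabs ((Ub *m (cu *m cadjmx cw + cw *m cadjmx cv) *m V^T) i i) <=
    (e * a i + b i / e) / 2 + (e * d i + c i / e) / 2.
  rewrite mulmxDr mulmxDl mxE !rank1 (le_trans (cabsD _ _))// lerD//.
    by rewrite cabsM cabs_conjc /a /b -!cabs_sqr amgm_scaled.
  by rewrite cabsM cabs_conjc mulrC /c /d -!cabs_sqr amgm_scaled.
apply: le_trans (ler_sum _ (fun i _ => H i)) _.
rewrite big_split /= -!mulr_suml !big_split /= -!mulr_sumr -!mulr_suml.
have sa : \sum_i a i <= M by exact: le_trans (bessel cu UbUb) _.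
have sb : \sum_i b i <= e ^+ 2 by exact: le_trans (bessel cw VbVb) _.
have sc : \sum_i c i <= e ^+ 2 by exact: le_trans (bessel cw UbUb) _.
have sd : \sum_i d i <= M by exact: le_trans (bessel cv VbVb) _.
have sbe : (\sum_i b i) / e <= e by rewrite ler_pdivrMr// -expr2.
have sce : (\sum_i c i) / e <= e by rewrite ler_pdivrMr// -expr2.
have eM1 : e * (\sum_i a i) <= e * M by rewrite ler_pM2l.
have eM2 : e * (\sum_i d i) <= e * M by rewrite ler_pM2l.
rewrite mulrDr mulr1; lra.
Qed.

Lemma trace_norm_cvg0 (X : nat -> op R) :
  (forall e : R, 0 < e -> \forall n \near \oo, (trace_norm (X n) <= e%:E)%E) ->
  (fun n => trace_norm (X n)) @ \oo --> (0 : R)%:E.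
Proof.
move=> Xe; apply/fine_cvgP; split.
  (* Convergence to a finite limit in the extended reals includes being eventually finite; any fixed
     bound, here 1, gives this. *)
  have := Xe 1 ltr01; apply: filterS => n Xn.
  by rewrite ge0_fin_numE ?trace_norm_ge0// (le_lt_trans Xn)// ltry.
apply/cvgrPdist_le => e e0; have := Xe e e0; apply: filterS => n Xn /=.
have X0 := trace_norm_ge0 (X n).
have Xf : trace_norm (X n) \is a fin_num.
  by rewrite ge0_fin_numE// (le_lt_trans Xn)// ltry.
rewrite sub0r normrN ger0_norm ?fine_ge0//.
by rewrite -lee_fin fineK.
Qed.

End TraceNorm.

(** * Ladder operators as band matrices, and their products and traces *)

Section Operators.
Variable R : realType.
Local Notation C := R[i].
Implicit Types (al be ga de : C) (u v w : nat -> R).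

(** Passing down from level [k] and back uses the weight of level [k - 1]; the value 0 at [k = 0]
    says that the vacuum has no lower level. *)
Definition shiftr u k : R := if k is k'.+1 then u k' else 0.

Definition diagop u : op R := fun m n => if m == n then rc (u m) else 0.

(** [al] times the lowering operator with weights [u] plus [be] times its transpose. This one family
    contains [a], its adjoint, [Q], [P], the transported spin generators and all differences between
    them. *)
Definition bandop al be u : op R :=
  fun m n => if n == m.+1 then al * rc (u m)
             else if m == n.+1 then be * rc (u n) else 0.

Lemma opadd_band al be ga de u :
  opadd (bandop al be u) (bandop ga de u) = bandop (al + ga) (be + de) u.
Proof.
apply/funext => m; apply/funext => n; rewrite /opadd /bandop.
by case: ifP => _; [|case: ifP => _]; rewrite -?mulrDl ?addr0.
Qed.

Lemma opsub_band al be ga de u :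
  opsub (bandop al be u) (bandop ga de u) = bandop (al - ga) (be - de) u.
Proof.
apply/funext => m; apply/funext => n; rewrite /opsub /bandop.
by case: ifP => _; [|case: ifP => _]; rewrite -?mulrBl ?subr0.
Qed.

Lemma opsub_band_weight al be (c : R) u v :
  opsub (bandop al be u) (opscale (rc c) (bandop al be v)) =
  bandop al be (fun k => u k - c * v k).
Proof.
apply/funext => m; apply/funext => n; rewrite /opsub /opscale /bandop.
case: ifP => _; [|case: ifP => _]; rewrite ?mulr0 ?subr0// rcB rcM; ring.
Qed.

Lemma opscale_band c al be u :
  opscale c (bandop al be u) = bandop (c * al) (c * be) u.
Proof.
apply/funext => m; apply/funext => n; rewrite /opscale /bandop.
by case: ifP => _; [|case: ifP => _]; rewrite ?mulrA ?mulr0.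
Qed.

Lemma adj_band al be u : adj (bandop al be u) = bandop (conjc be) (conjc al) u.
Proof.
apply/funext => m; apply/funext => n; rewrite /adj /bandop.
case: (eqVneq m n.+1) => [->|_].
  by rewrite -[_ == n.+2]/(n == n.+2) [n == n.+2]ltn_eqF// rmorphM /= oppr0.
by case: ifP => _; rewrite ?rmorph0// rmorphM /= oppr0.
Qed.

(** Two paths of length two return to level [k]: through [k + 1], giving [al * de], and through
    [k - 1], giving [be * ga]. *)
Lemma opmul_band_diag al be ga de u v k :
  opmul (bandop al be u) (bandop ga de v) k k =
  al * de * rc (u k * v k) + be * ga * rc (shiftr (fun l => u l * v l) k).
Proof.
have e1 n : (n == n.+1) = false by rewrite ltn_eqF.
have e2 n : (n.+1 == n) = false by rewrite gtn_eqF.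
have e3 n : (n == n.+2) = false by rewrite ltn_eqF.
have e4 n : (n.+2 == n) = false by rewrite gtn_eqF.
rewrite /opmul (@series_finite_cvg _ _ k.+2); last first.
  move=> l kl; rewrite /bandop [l == k.+1]gtn_eqF// [k == l.+1]ltn_eqF ?mul0r//.
  by rewrite ltnS (leq_trans _ kl)// leqW.
case: k => [|k].
  rewrite !big_nat_recr//= big_nil /bandop /= rcM rc0; ring.
rewrite !big_nat_recr//= big_nat_cond big1; last first.
  move=> l /andP[/andP[_ lk] _].
  rewrite /bandop [l == k.+2]ltn_eqF ?[k.+1 == l.+1]gtn_eqF ?mul0r//.
  by rewrite ltnW// ltnW.
by rewrite /bandop !eqSS !eqxx ?e1 ?e2 ?e3 ?e4 !rcM; ring.
Qed.

Lemma opmul_diag_diag r (Z : op R) m :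
  opmul (diagop r) Z m m = rc (r m) * Z m m.
Proof.
rewrite /opmul (@series_finite_cvg _ _ m.+1); last first.
  by move=> k mk; rewrite /diagop ltn_eqF ?mul0r.
rewrite big_nat_recr//= /diagop eqxx big_nat_cond big1 ?add0r//.
by move=> k /andP[/andP[_ km] _]; rewrite gtn_eqF ?mul0r.
Qed.

(** Against a diagonal density only the diagonal of [Z] counts, so [Z] enters through the sequence
    [w] alone. This form serves the spin state; the next one, with a convergent series, serves the
    thermal state. *)
Lemma trace_diag_finite r (Z : op R) w K :
  (forall k, (K <= k)%N -> r k = 0) -> (forall k, Z k k = rc (w k)) ->
  trace (opmul (diagop r) Z) = rc (\sum_(0 <= k < K) r k * w k).
Proof.
move=> r0 Zw; rewrite /trace.
rewrite (_ : (fun m => _) = fun m => rc (r m * w m)).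
  rewrite (@series_finite_cvg _ _ K) ?rc_sum// => k Kk.
  by rewrite r0// mul0r.
by apply/funext => m; rewrite opmul_diag_diag Zw rcM.
Qed.

Lemma trace_diag_series r (Z : op R) w :
  cvgn (series (fun k => r k * w k)) -> (forall k, Z k k = rc (w k)) ->
  trace (opmul (diagop r) Z) = rc (limn (series (fun k => r k * w k))).
Proof.
move=> cv Zw; rewrite /trace; apply: lim_complex.
rewrite (_ : series _ = fun K => rc (series (fun k => r k * w k) K)).
  exact: rc_cvg.
apply/funext => K; rewrite /series /= rc_sum; apply: eq_bigr => k _.
by rewrite opmul_diag_diag Zw rcM.
Qed.

Lemma jval_sub_mval n (i : 'I_n.+1) : jval R n - mval R i = i%:R.
Proof. by rewrite /mval opprB addrC subrK. Qed.

(** Since [j - m_i = i], the isometry identifies the spin space with the first [n + 1] number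
    states, and transport pads a matrix with zeros. *)
Lemma transportE n (X : 'M[C]_n.+1) r s :
  transport X r s = if (r <= n)%N && (s <= n)%N then X (inord r) (inord s) else 0.
Proof.
have W t (i : 'I_n.+1) : Wj R t i = if t == i then 1 else 0.
  by rewrite /Wj jval_sub_mval eqr_nat.
rewrite /transport; have [rn|rn] := leqP r n; last first.
  rewrite big1//= => i _; rewrite big1// => k _.
  by rewrite W gtn_eqF ?mul0r// (leq_trans (ltn_ord i)).
have [sn|sn] := leqP s n; last first.
  rewrite big1//= => i _; rewrite big1// => k _.
  by rewrite [Wj R s k]W gtn_eqF ?rmorph0 ?mulr0// (leq_trans (ltn_ord k)).
rewrite (bigD1 (inord r))//= [X in _ + X]big1 ?addr0.
  rewrite (bigD1 (inord s))//= [X in _ + X]big1 ?addr0.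
    by rewrite !W !inordK// !eqxx rmorph1 mulr1 mul1r.
  move=> k ks; rewrite [Wj R s k]W ifN ?rmorph0 ?mulr0//.
  by apply: contra ks => /eqP ->; rewrite inord_val.
move=> i ir; rewrite big1// => k _; rewrite W ifN ?mul0r//.
by apply: contra ir => /eqP ->; rewrite inord_val.
Qed.

Definition fockw : nat -> R := fun k => Num.sqrt k.+1%:R.

(** With [k = j - m] and [n = 2j], this is [sqrt ((j-m+1) (j+m))] from the ladder relations at
    [m = j - k]. As [Num.sqrt] is 0 on negative numbers, the weights vanish for all [k >= n], where
    the spin space ends. *)
Definition spinw (n : nat) : nat -> R :=
  fun k => Num.sqrt (k.+1%:R * (n%:R - k%:R)).

Lemma spinw_eq0 n k : (n <= k)%N -> spinw n k = 0.
Proof.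
by move=> nk; rewrite /spinw ler0_sqrtr// mulr_ge0_le0// subr_le0 ler_nat.
Qed.

Lemma annE : ann R = bandop 1 0 fockw.
Proof.
apply/funext => m; apply/funext => n; rewrite /ann /bandop.
by case: eqP => [->|_]; rewrite ?mul1r// mul0r if_same.
Qed.

Lemma creE : cre R = bandop 0 1 fockw.
Proof. by rewrite /cre annE adj_band rmorph0 rmorph1. Qed.

(** The number index is [j - m], so raising [m] lowers the number and [J_+] lies on the same side of
    the diagonal as [a]. *)
Lemma JplusE n : transport (Jplus R n) = bandop 1 0 (spinw n).
Proof.
apply/funext => r; apply/funext => s; rewrite transportE /bandop mul0r if_same mul1r.
case: ifP => [/andP[rn sn]|].
  rewrite mxE jval_sub_mval !inordK//.
  have -> : (mval R (inord r : 'I_n.+1) == mval R (inord s : 'I_n.+1) + 1) = (s == r.+1).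
    rewrite /mval !inordK// -(eqr_nat R) -natr1 -subr_eq0 -[RHS]subr_eq0.
    by congr (_ == _); ring.
  case: eqP => // sr; rewrite /spinw /mval inordK// /jval sr.
  by congr (rc (Num.sqrt _)); rewrite -natr1; field.
(* Outside the block the transported entry is 0, and on the band this agrees with the vanishing
   weight, also at the corner [r = n], [s = n + 1]. *)
case: eqP => // -> /negbT; rewrite negb_and -!ltnNge => h.
by rewrite spinw_eq0//; case/orP: h => // /ltnW.
Qed.

Lemma JminusE n : transport (Jminus R n) = bandop 0 1 (spinw n).
Proof.
apply/funext => r; apply/funext => s; rewrite transportE /bandop mul0r mul1r.
case: ifP => [/andP[rn sn]|].
  rewrite mxE jval_sub_mval !inordK//.
  have -> : (mval R (inord r : 'I_n.+1) == mval R (inord s : 'I_n.+1) - 1) = (r == s.+1).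
    rewrite /mval !inordK// -(eqr_nat R) -natr1 -subr_eq0 -[RHS]subr_eq0 -oppr_eq0.
    by congr (_ == _); ring.
  case: (eqVneq r s.+1) => [->|_]; last by rewrite if_same.
  rewrite [s == s.+2]ltn_eqF// /spinw /mval inordK// /jval.
  by congr (rc (Num.sqrt _)); rewrite -natr1; field.
case: (eqVneq r s.+1) => [->|_]; last by rewrite if_same.
rewrite [s == s.+2]ltn_eqF// => /negbT; rewrite negb_and -!ltnNge => h.
by rewrite spinw_eq0//; case/orP: h => // /ltnW.
Qed.

Lemma transportD n (X Y : 'M[C]_n.+1) :
  transport (X + Y) = opadd (transport X) (transport Y).
Proof.
apply/funext => r; apply/funext => s; rewrite /opadd !transportE mxE.
by case: ifP; rewrite ?addr0.
Qed.

Lemma transportB n (X Y : 'M[C]_n.+1) :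
  transport (X - Y) = opsub (transport X) (transport Y).
Proof.
apply/funext => r; apply/funext => s; rewrite /opsub !transportE !mxE.
by case: ifP; rewrite ?subr0.
Qed.

Lemma transportZ n c (X : 'M[C]_n.+1) :
  transport (c *: X) = opscale c (transport X).
Proof.
apply/funext => r; apply/funext => s; rewrite /opscale !transportE !mxE.
by case: ifP; rewrite ?mulr0.
Qed.

(** The common weight sequence of all four differences between a Fock operator and its rescaled spin
    counterpart. *)
Definition defectw (n : nat) : nat -> R :=
  fun k => fockw k - (Num.sqrt n%:R)^-1 * spinw n k.

Definition sC : C := rc (1 / Num.sqrt 2).
Definition cC : C := (iC R * rc (Num.sqrt 2))^-1.

Lemma QopE : Qop R = bandop sC sC fockw.
Proof. by rewrite /Qop annE creE opadd_band opscale_band addr0 add0r mulr1. Qed.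

Lemma PopE : Pop R = bandop cC (- cC) fockw.
Proof.
by rewrite /Pop annE creE opsub_band opscale_band subr0 sub0r mulr1 mulrN1.
Qed.

(** Reconciles the two scalings: [1/sqrt j] is [sqrt 2 / sqrt (2j)], and the extra [sqrt 2] turns
    the factors [1/2] and [1/(2i)] of [J1] and [J2] into the factors [1/sqrt 2] and [1/(i sqrt 2)]
    of [Q] and [P]. *)
Lemma sqrt_half_inv n :
  (Num.sqrt (jval R n))^-1 = Num.sqrt 2 * (Num.sqrt n%:R)^-1.
Proof. by rewrite /jval sqrtrM// sqrtrV// invfM invrK mulrC. Qed.

Lemma sqrt2_neq0 : Num.sqrt 2 != 0 :> R.
Proof. by rewrite gt_eqF// sqrtr_gt0. Qed.

Lemma sqrt2_half : Num.sqrt 2 * (1 / 2) = 1 / Num.sqrt 2 :> R.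
Proof.
rewrite !mul1r; apply: (mulIf sqrt2_neq0); rewrite mulVf ?sqrt2_neq0// mulrAC.
by rewrite -expr2 sqr_sqrtr// divff.
Qed.

Lemma defect_annE n :
  opsub (ann R) (opscale (rc (Num.sqrt n%:R))^-1 (transport (Jplus R n))) =
  bandop 1 0 (defectw n).
Proof. by rewrite annE JplusE -rcV opsub_band_weight. Qed.

Lemma defect_creE n :
  opsub (cre R) (opscale (rc (Num.sqrt n%:R))^-1 (transport (Jminus R n))) =
  bandop 0 1 (defectw n).
Proof. by rewrite creE JminusE -rcV opsub_band_weight. Qed.

Lemma defect_QE n :
  opsub (Qop R) (opscale (rc (Num.sqrt (jval R n)))^-1 (transport (J1 R n))) =
  bandop sC sC (defectw n).
Proof.
rewrite QopE /J1 transportZ transportD JplusE JminusE opadd_band addr0 add0r.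
rewrite -rcV sqrt_half_inv -opsub_band_weight rcM; congr opsub.
rewrite !opscale_band /sC; congr bandop;
  by rewrite mulr1 mulrAC -(rcM (Num.sqrt 2) (1 / 2)) sqrt2_half mulrC.
Qed.

Lemma defect_PE n :
  opsub (Pop R) (opscale (rc (Num.sqrt (jval R n)))^-1 (transport (J2 R n))) =
  bandop cC (- cC) (defectw n).
Proof.
have h : rc (Num.sqrt 2) * (rc 2 * iC R)^-1 = cC.
  by rewrite /cC !invfM mulrA -!rcV -[2^-1]mul1r
    -(rcM (Num.sqrt 2) (1 / 2)) sqrt2_half mul1r mulrC.
rewrite PopE /J2 transportZ transportB JplusE JminusE opsub_band subr0 sub0r.
rewrite -rcV sqrt_half_inv -opsub_band_weight rcM; congr opsub.
by rewrite !opscale_band; congr bandop; rewrite ?mulrN1 ?mulr1 ?mulrN mulrAC h mulrC.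
Qed.

End Operators.

(** * Convergence of the spin states to the thermal state *)

Section ThermalLimit.
Variables (R : realType) (p : R).
Hypotheses (p0 : 0 < p) (p1 : p < 1).

Definition spinr (n k : nat) : R :=
  if (k <= n)%N then (1 - p) / (1 - p ^+ n.+1) * p ^+ k else 0.

Definition thermr (k : nat) : R := (1 - p) * p ^+ k.

Lemma transport_spin_state n : transport (spin_state p n) = diagop (spinr n).
Proof.
apply/funext => r; apply/funext => s; rewrite transportE /diagop /spinr.
case: (leqP r n) => [rn|rn] /=; last by rewrite rc0 if_same.
case: (leqP s n) => sn; last by rewrite ltn_eqF ?(leq_ltn_trans rn).
by rewrite mxE -(inj_eq val_inj) /= !inordK.
Qed.

(** For [N = p / (1 - p)] one has [1 / (N + 1) = 1 - p] and [N / (N + 1) = p]. *)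
Lemma thermalE : thermal (p / (1 - p)) = diagop thermr.
Proof.
have q0 : 1 - p != 0 by rewrite gt_eqF// subr_gt0.
have e : p / (1 - p) + 1 = (1 - p)^-1.
  by rewrite -{2}(divff q0) -mulrDl addrC subrK mul1r.
apply/funext => r; apply/funext => s; rewrite /thermal /diagop /thermr e invrK.
by rewrite mul1r divfK.
Qed.

Let pX n : 0 < 1 - p ^+ n.+1.
Proof. by rewrite subr_gt0 exprn_ilt1 ?(ltW p0). Qed.

(** [p^(n+1) <= p] keeps the normalising factor at most 1, so the weights are dominated by [p^k]
    uniformly in [n]. *)
Lemma spinr_norm_bound n : 0 <= (1 - p) / (1 - p ^+ n.+1) <= 1.
Proof.
have q0 : 0 < 1 - p by rewrite subr_gt0.
rewrite divr_ge0 ?(ltW q0) ?(ltW (pX n))//= ler_pdivrMr// mul1r lerB//.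
by rewrite exprS ler_piMr ?(ltW p0)// exprn_ile1 ?(ltW p0) ?(ltW p1).
Qed.

Lemma spinr_bound n k : 0 <= spinr n k <= p ^+ k.
Proof.
have pk : 0 <= p ^+ k by rewrite exprn_ge0 ?(ltW p0).
rewrite /spinr; case: ifP => _; last by rewrite lexx.
by have /andP[c0 c1] := spinr_norm_bound n; rewrite mulr_ge0//= ler_piMl.
Qed.

Lemma thermr_bound k : 0 <= thermr k <= p ^+ k.
Proof.
have pk : 0 <= p ^+ k by rewrite exprn_ge0 ?(ltW p0).
by rewrite mulr_ge0 ?subr_ge0 ?(ltW p1)//= ler_piMl// gerBl (ltW p0).
Qed.

Lemma spinr_cvg k : spinr ^~ k @ \oo --> thermr k.
Proof.
have H : {near \oo, (fun n => (1 - p) / (1 - p ^+ n.+1) * p ^+ k) =1 spinr ^~ k}.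
  by near=> n; rewrite /spinr ifT//; near: n; exact: nbhs_infty_ge.
apply: cvg_trans (near_eq_cvg H) _.
have -> : thermr k = (1 - p) / (1 - 0) * p ^+ k by rewrite subr0 divr1.
apply: cvgM; last exact: cvg_cst.
apply: cvgM; first exact: cvg_cst.
apply: cvgV; first by rewrite subr0 oner_neq0.
apply: cvgB; first exact: cvg_cst.
have := @cvg_expr R p; rewrite (ger0_norm (ltW p0)) => /(_ p1).
by rewrite -cvg_shiftS.
Unshelve. all: by end_near. Qed.

Lemma thermr_weight_cvg (c : R) (w : nat -> R) :
  (forall k, `|w k| <= c * k.+1%:R) ->
  cvgn (series (fun k => thermr k * w k)).
Proof.
move=> wc; apply: normed_cvg.
apply: (@series_le_cvg _ _ (fun k => c * (k.+1%:R * p ^+ k))) => [k|k|k|].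
- exact: normr_ge0.
- by rewrite mulrA mulr_ge0 ?exprn_ge0 ?(ltW p0)// (le_trans _ (wc k)).
- have /andP[t0 t1] := thermr_bound k.
  rewrite /= normrM ger0_norm// mulrA mulrC ler_pM//.
- by apply: is_cvg_seriesZ; exact: cvg_series_arith_geometric.
Qed.

(** The dominated convergence statement behind all the trace limits: diagonals growing at most
    linearly, uniformly in [n], and converging entrywise give convergent expectations. *)
Lemma trace_spin_cvg (c : R) (w : nat -> nat -> R) (w0 : nat -> R)
    (Z : nat -> op R) (Z0 : op R) :
  (forall n k, `|w n k| <= c * k.+1%:R) ->
  (forall k, w ^~ k @ \oo --> w0 k) ->
  (forall n k, Z n k k = rc (w n k)) -> (forall k, Z0 k k = rc (w0 k)) ->
  (fun n => trace (opmul (transport (spin_state p n)) (Z n))) @ \oo -->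
  trace (opmul (thermal (p / (1 - p))) Z0).
Proof.
move=> wc ww Zw Z0w.
have w0c k : `|w0 k| <= c * k.+1%:R.
  apply: cvgr_to_le (cvg_norm (ww k)) _.
  by near=> n; exact: wc.
have c0 : 0 <= c by have := wc 0%N 0%N; rewrite mulr1; exact: le_trans.
have cv := thermr_weight_cvg w0c.
have p_ge0 k : 0 <= p ^+ k by rewrite exprn_ge0 ?(ltW p0).
rewrite thermalE (trace_diag_series cv Z0w).
rewrite (_ : (fun n => _) = fun n => rc (\sum_(0 <= k < n.+1) spinr n k * w n k));
    last first.
  apply/funext => n; rewrite transport_spin_state.
  by apply: (@trace_diag_finite _ _ _ _ n.+1) => // k nk; rewrite /spinr leqNgt nk.
apply: rc_cvg.
pose d n k := `|spinr n k * w n k - thermr k * w0 k|.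
have d0 k : d ^~ k @ \oo --> 0.
  apply/norm_cvg0P.
  have := cvgB (cvgM (spinr_cvg (k := k)) (ww k)) (cvg_cst (thermr k * w0 k)).
  by rewrite subrr; apply.
have dg n k : 0 <= d n k <= 2 * c * (k.+1%:R * p ^+ k).
  rewrite normr_ge0/= (le_trans (ler_normB _ _))//.
  rewrite (normrM (spinr n k)) (normrM (thermr k)).
  have /andP[s0 s1] := spinr_bound n k; have /andP[t0 t1] := thermr_bound k.
  rewrite (ger0_norm s0) (ger0_norm t0).
  rewrite -mulrA mulr_natl mulr2n lerD// mulrA mulrC ler_pM//.
have cg : cvgn (series (fun k => 2 * c * (k.+1%:R * p ^+ k))).
  by apply: is_cvg_seriesZ; exact: cvg_series_arith_geometric.
have ss : (fun n => series (fun k => thermr k * w0 k) n.+1) @ \oo -->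
    limn (series (fun k => thermr k * w0 k)).
  by have := cv; rewrite -[X in X -> _]cvg_shiftS.
rewrite -(add0r (limn (series (fun k => thermr k * w0 k)))).
(* Split the spin trace into its difference from the thermal partial sum, which vanishes by Tannery,
   and that partial sum itself. *)
rewrite (_ : (fun n => _) = fun n =>
  (\sum_(0 <= k < n.+1) (spinr n k * w n k - thermr k * w0 k)) +
  series (fun k => thermr k * w0 k) n.+1); last first.
  by apply/funext => n; rewrite /series /= -big_split /=;
    apply: eq_bigr => k _; rewrite subrK.
apply: cvgD ss; apply/cvgr0Pnorm_le => e e0.
have H : \forall n \near \oo, forall k, 0 <= d n k <= 2 * c * (k.+1%:R * p ^+ k).
  by near=> n => k.
have := tannery0 H cg d0 e0; apply: filterS => n dn.
by apply: le_trans (dn n.+1); exact: ler_norm_sum.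
Unshelve. all: by end_near. Qed.

Lemma trace_norm_spin_cvg :
  (fun n => trace_norm (opsub (transport (spin_state p n))
                              (thermal (p / (1 - p))))) @ \oo --> (0 : R)%:E.
Proof.
rewrite thermalE; apply: trace_norm_cvg0 => e e0.
pose d n k := `|spinr n k - thermr k|.
have d0 k : d ^~ k @ \oo --> 0.
  apply/norm_cvg0P.
  have := cvgB (spinr_cvg (k := k)) (cvg_cst (thermr k)).
  by rewrite subrr; apply.
(* Both weights lie in [[0, p^k]]; the factor [k + 1] only allows the series already shown
   convergent to be reused. *)
have dg n k : 0 <= d n k <= k.+1%:R * p ^+ k.
  have /andP[s0 s1] := spinr_bound n k; have /andP[t0 t1] := thermr_bound k.
  have pk : 0 <= p ^+ k by rewrite exprn_ge0 ?(ltW p0).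
  rewrite normr_ge0/= (@le_trans _ _ (p ^+ k))//; last by rewrite ler_peMl// ler1n.
  by rewrite ler_norml; lra.
have H : \forall n \near \oo, forall k, 0 <= d n k <= k.+1%:R * p ^+ k.
  by near=> n => k.
have := tannery0 H (cvg_series_arith_geometric p0 p1) d0 e0.
apply: filterS => n dn; apply: trace_norm_diag_le => [m k mk|K].
  by rewrite /opsub transport_spin_state /diagop (negbTE mk) subr0.
apply: le_trans (dn K); apply: ler_sum => k _.
by rewrite /opsub transport_spin_state /diagop eqxx -rcB cabs_rc.
Unshelve. all: by end_near. Qed.

End ThermalLimit.

(** * The Poisson limit of binomial weights *)

Section CoherentLimit.
Variable R : realType.
Implicit Types x : R.

Lemma cvg_divn x : (fun n : nat => x / n%:R) @ \oo --> (0 : R).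
Proof.
rewrite -(mulr0 x); apply: cvgM; first exact: cvg_cst.
apply/gtr0_cvgV0; last exact: cvgr_idn.
by near=> n; rewrite ltr0n; near: n; exact: nbhs_infty_gt.
Unshelve. all: by end_near. Qed.

Lemma cvg_1subdivn x : (fun n : nat => 1 - x / n%:R) @ \oo --> (1 : R).
Proof.
have := cvgB (cvg_cst (1 : R)) (@cvg_divn x).
by rewrite subr0; apply.
Qed.

Lemma near_gtn x : \forall n \near \oo, x < n%:R.
Proof. by near=> n; near: n; exact: nbhs_infty_gtr. Unshelve. all: by end_near. Qed.

(** Squeeze with [t = x/n]: both bounds in [exp (-t/(1-t)) <= 1 - t <= exp (-t)] come from
    [1 + y <= exp y], the lower one after inversion. Then take [n]-th powers. *)
Lemma cvg_exp_1subdivn x : 0 <= x ->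
  (fun n : nat => (1 - x / n%:R) ^+ n) @ \oo --> expR (- x).
Proof.
move=> x0; apply: (@squeeze_cvgr _ _ _ _
  (fun n : nat => expR (- x / (1 - x / n%:R))) (fun=> expR (- x))).
- near=> n.
  have xn : x < n%:R by near: n; exact: near_gtn.
  have n0 : 0 < n%:R :> R by exact: le_lt_trans xn.
  have n1 : n%:R != 0 :> R by rewrite gt_eqF.
  have t1 : 0 < 1 - x / n%:R by rewrite subr_gt0 ltr_pdivrMr// mul1r.
  apply/andP; split.
    have -> : - x / (1 - x / n%:R) = n%:R * - ((x / n%:R) / (1 - x / n%:R)).
      by field; rewrite n1/= subr_eq0 gt_eqF.
    rewrite expRM_natl; apply: lerXn2r; rewrite ?nnegrE ?expR_ge0 ?(ltW t1)//.
    rewrite expRN -[leRHS]invrK lef_pV2 ?posrE ?expR_gt0 ?invr_gt0//.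
    apply: le_trans (expR_ge1Dx _).
    by rewrite le_eqVlt; apply/orP; left; apply/eqP; field; rewrite n1/= subr_eq0 gt_eqF.
  have -> : - x = n%:R * - (x / n%:R) by field.
  rewrite expRM_natl; apply: lerXn2r; rewrite ?nnegrE ?expR_ge0 ?(ltW t1)//.
  exact: expR_ge1Dx.
- have h : (fun n : nat => - x / (1 - x / n%:R)) @ \oo --> - x / 1.
    apply: cvgM; first exact: cvg_cst.
    by apply: cvgV; [exact: oner_neq0|exact: cvg_1subdivn].
  by move: h; rewrite divr1 => h;
    apply: (@continuous_cvg _ _ _ _ _ _ expR _ _ h); exact: continuous_expR.
- exact: cvg_cst.
Unshelve. all: by end_near. Qed.

(** The quotient is the product of the factors [1 - i/n] for [i < k], each tending to 1. *)
Lemma cvg_ffact_divX k :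
  (fun n : nat => (n ^_ k)%:R / n%:R ^+ k) @ \oo --> (1 : R).
Proof.
elim: k => [|k IH].
  by under eq_fun do rewrite ffactn0 expr0 divr1; exact: cvg_cst.
have H : {near \oo, (fun n : nat => (n ^_ k)%:R / n%:R ^+ k * (1 - k%:R / n%:R))
                    =1 (fun n : nat => (n ^_ k.+1)%:R / n%:R ^+ k.+1 : R)}.
  near=> n.
  have kn : (k < n)%N by near: n; exact: nbhs_infty_gt.
  have n1 : n%:R != 0 :> R by rewrite pnatr_eq0 -lt0n (leq_ltn_trans _ kn).
  rewrite ffactnSr natrM natrB ?(ltnW kn)// exprSr.
  by field; rewrite n1 expf_neq0.
apply: cvg_trans (near_eq_cvg H) _.
by have := cvgM IH (@cvg_1subdivn k%:R); rewrite mulr1; apply.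
Unshelve. all: by end_near. Qed.

(** The binomial probability with success rate [x/n], divided by [x^k]; [poissonw] is the Poisson
    probability divided by [x^k]. The factor [x^k] is left out because it is the squared modulus of
    the power [z^k] common to both coherent vectors. *)
Definition binomw x n k : R :=
  'C(n, k)%:R / n%:R ^+ k * (1 - x / n%:R) ^+ (n - k).

Definition poissonw x k : R := expR (- x) / k`!%:R.

Lemma fact_neq0 k : k`!%:R != 0 :> R.
Proof. by rewrite pnatr_eq0 -lt0n fact_gt0. Qed.

Lemma binE n k : 'C(n, k)%:R = (n ^_ k)%:R / k`!%:R :> R.
Proof. by rewrite -bin_ffact natrM mulfK ?fact_neq0. Qed.

(** The law of rare events: write the power [n - k] as a quotient of the powers [n] and [k]; the
    first tends to [exp (-x)], the second to 1. *)
Lemma binomw_cvg x k : 0 <= x -> binomw x ^~ k @ \oo --> poissonw x k.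
Proof.
move=> x0.
have H : {near \oo, (fun n : nat => (n ^_ k)%:R / n%:R ^+ k / k`!%:R *
    ((1 - x / n%:R) ^+ n / (1 - x / n%:R) ^+ k)) =1 binomw x ^~ k}.
  near=> n.
  have kn : (k <= n)%N by near: n; exact: nbhs_infty_ge.
  have xn : x < n%:R by near: n; exact: near_gtn.
  have n0 : 0 < n%:R :> R by exact: le_lt_trans xn.
  have t1 : 1 - x / n%:R != 0 by rewrite gt_eqF// subr_gt0 ltr_pdivrMr// mul1r.
  rewrite /binomw binE expfB_cond ?(negbTE t1) ?add0n//.
  by rewrite [X in X * _]mulrAC.
apply: cvg_trans (near_eq_cvg H) _.
have -> : poissonw x k = 1 / k`!%:R * (expR (- x) / 1 ^+ k).
  by rewrite /poissonw expr1n divr1 mul1r mulrC.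
apply: cvgM.
  by apply: cvgM; [exact: cvg_ffact_divX|exact: cvg_cst].
apply: cvgM; first exact: cvg_exp_1subdivn.
apply: cvgV; first by rewrite expr1n oner_neq0.
elim: (k) => [|m IH]; first by under eq_fun do rewrite expr0; exact: cvg_cst.
under eq_fun do rewrite exprS.
by rewrite exprS; exact: (cvgM (@cvg_1subdivn x) IH).
Unshelve. all: by end_near. Qed.

(** The falling factorial is at most [n^k], and [1 - x/n] lies in [[0, 1]]. Multiplied by [x^k], the
    bound is a term of the exponential series. *)
Lemma binomw_bound x n k : 0 <= x -> x < n%:R ->
  0 <= binomw x n k <= (k`!%:R)^-1.
Proof.
move=> x0 xn.
have n0 : 0 < n%:R :> R by exact: le_lt_trans xn.
have t0 : 0 <= 1 - x / n%:R by rewrite subr_ge0 ler_pdivrMr// mul1r ltW.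
have t1 : 1 - x / n%:R <= 1 by rewrite gerBl divr_ge0// ltW.
have c0 : 0 <= 'C(n, k)%:R / n%:R ^+ k :> R by rewrite divr_ge0// exprn_ge0// ltW.
rewrite mulr_ge0 ?exprn_ge0//=.
apply: (@le_trans _ _ ('C(n, k)%:R / n%:R ^+ k)).
  by rewrite ler_piMr// exprn_ile1.
rewrite binE mulrAC ler_piMl ?invr_ge0// ler_pdivrMr ?exprn_gt0// mul1r.
rewrite -natrX ler_nat.
elim: k {c0} => [|k IH]; first by rewrite ffactn0 expn0.
by rewrite ffactnSr expnSr leq_mul ?leq_subr.
Qed.

Lemma poissonw_bound x k : 0 <= x -> 0 <= poissonw x k <= (k`!%:R)^-1.
Proof.
move=> x0; rewrite divr_ge0 ?expR_ge0//= ler_piMl ?invr_ge0//.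
by rewrite -expR0 ler_expR oppr_le0.
Qed.

(** * Convergence of the spin coherent vectors *)

Section FixedPoint.
Variable z : R[i].
Let x := csq z.
Let x0 : 0 <= x. Proof. exact: csq_ge0. Qed.

(** Once [z^k] is factored out, a nonnegative real root remains. The spin coherent vector has the
    same shape with a binomial weight, so comparing the vectors reduces to comparing real square
    roots. *)
Lemma cohE k : coh z k = z ^+ k * rc (Num.sqrt (poissonw x k)).
Proof.
have -> : Num.sqrt (poissonw x k) = expR (- x / 2) / Num.sqrt k`!%:R.
  rewrite -[RHS]ger0_norm ?divr_ge0 ?expR_ge0 ?sqrtr_ge0// -sqrtr_sqr.
  congr Num.sqrt; rewrite expr_div_n sqr_sqrtr// /poissonw; congr (_ / _).
  by rewrite expr2 -expRD -splitr.
by rewrite /coh cabs_sqr rcM rcV; ring.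
Qed.

Lemma spin_cohE n k : x < n%:R -> (k <= n)%N ->
  spin_coh n (z / rc (Num.sqrt n%:R)) (inord k) =
  z ^+ k * rc (Num.sqrt (binomw x n k)).
Proof.
move=> xn kn.
have n0 : 0 < n%:R :> R by exact: le_lt_trans xn.
have t0 : 0 <= 1 - x / n%:R by rewrite subr_ge0 ler_pdivrMr// mul1r ltW.
have w0 : cabs (z / rc (Num.sqrt n%:R)) ^+ 2 = x / n%:R.
  by rewrite cabs_sqr csqM -rcV csq_rc exprVn sqr_sqrtr ?(ltW n0).
rewrite /spin_coh inordK// w0 exprMn -rcV -rcX bin_sub//.
pose A : R := Num.sqrt 'C(n, k)%:R * (Num.sqrt n%:R)^-1 ^+ k *
  (1 - x / n%:R) `^ ((n - k)%:R / 2).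
have -> : Num.sqrt (binomw x n k) = A.
  have A0 : 0 <= A.
    by rewrite !mulr_ge0 ?exprn_ge0 ?invr_ge0 ?sqrtr_ge0 ?powR_ge0.
  rewrite -[RHS]ger0_norm// -sqrtr_sqr; congr Num.sqrt.
  rewrite /A !exprMn sqr_sqrtr// exprAC exprVn sqr_sqrtr ?(ltW n0)// exprVn.
  by rewrite powRrM powR_mulrn// powR12_sqrt ?exprn_ge0// sqr_sqrtr ?exprn_ge0.
rewrite /A !(rcM (_ * _)) (rcM (Num.sqrt 'C(n, k)%:R)); ring.
Qed.

(** The image of the spin vector in the Fock space; the test [k <= n] keeps [inord] away from its
    default value. *)
Definition spin_coh_fock n k : R[i] :=
  if (k <= n)%N then spin_coh n (z / rc (Num.sqrt n%:R)) (inord k) else 0.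

Lemma transport_spin_ketbra n :
  transport (spin_ketbra (spin_coh n (z / rc (Num.sqrt n%:R)))) =
  ketbra (spin_coh_fock n).
Proof.
apply/funext => r; apply/funext => s; rewrite transportE /ketbra /spin_coh_fock.
case: ifP => [/andP[-> ->]|]; first by rewrite mxE.
by case: (r <= n)%N => /= [->|_]; rewrite ?conjc0 ?mulr0// mul0r.
Qed.

Lemma csq_coh_le k : csq (coh z k) <= exp_coeff x k.
Proof.
have /andP[b0 b1] := poissonw_bound k x0.
by rewrite cohE csqM csqX csq_rc sqr_sqrtr// /exp_coeff ler_wpM2l ?exprn_ge0.
Qed.

Lemma csq_spin_coh_le n k : x < n%:R -> csq (spin_coh_fock n k) <= exp_coeff x k.
Proof.
move=> xn; rewrite /spin_coh_fock; case: ifP => kn; last first.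
  by rewrite -rc0 csq_rc expr0n exp_coeff_ge0.
have /andP[b0 b1] := binomw_bound k x0 xn.
by rewrite spin_cohE// csqM csqX csq_rc sqr_sqrtr// /exp_coeff ler_wpM2l ?exprn_ge0.
Qed.

Lemma csq_spin_coh_sub n k : x < n%:R -> (k <= n)%N ->
  csq (spin_coh_fock n k - coh z k) =
  x ^+ k * (Num.sqrt (binomw x n k) - Num.sqrt (poissonw x k)) ^+ 2.
Proof.
move=> xn kn; rewrite /spin_coh_fock kn spin_cohE// cohE -mulrBr -rcB.
by rewrite csqM csqX csq_rc.
Qed.

(** For [k <= n] two roots in [[0, s]] with [s^2 = 1/k!] differ by at most [s]; for [k > n] the spin
    entry is 0 and the Fock entry alone is bounded. *)
Lemma csq_spin_coh_sub_le n k : x < n%:R ->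
  csq (spin_coh_fock n k - coh z k) <= exp_coeff x k.
Proof.
move=> xn; have [kn|nk] := leqP k n; last first.
  rewrite /spin_coh_fock leqNgt nk /= sub0r.
  have -> : csq (- coh z k) = csq (coh z k).
    by rewrite -mulN1r csqM -rc1 -rcN csq_rc sqrrN expr1n mul1r.
  exact: csq_coh_le.
rewrite csq_spin_coh_sub// /exp_coeff ler_wpM2l ?exprn_ge0//.
have /andP[b0 b1] := binomw_bound k x0 xn.
have /andP[c0 c1] := poissonw_bound k x0.
pose s : R := Num.sqrt (k`!%:R)^-1.
have sb : Num.sqrt (binomw x n k) <= s by rewrite ler_wsqrtr.
have sc : Num.sqrt (poissonw x k) <= s by rewrite ler_wsqrtr.
have pb := sqrtr_ge0 (binomw x n k); have pc := sqrtr_ge0 (poissonw x k).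
have -> : (k`!%:R)^-1 = s ^+ 2 by rewrite sqr_sqrtr// invr_ge0.
by rewrite -subr_ge0 subr_sqr mulr_ge0//; lra.
Qed.

Lemma csq_spin_coh_sub_cvg k :
  (fun n => csq (spin_coh_fock n k - coh z k)) @ \oo --> (0 : R).
Proof.
have H : {near \oo, (fun n => x ^+ k *
    (Num.sqrt (binomw x n k) - Num.sqrt (poissonw x k)) ^+ 2) =1
    (fun n => csq (spin_coh_fock n k - coh z k))}.
  near=> n; rewrite csq_spin_coh_sub//; near: n; first exact: near_gtn.
  exact: nbhs_infty_ge.
apply: cvg_trans (near_eq_cvg H) _.
have s0 : (fun n => Num.sqrt (binomw x n k) - Num.sqrt (poissonw x k)) @ \oo --> (0 : R).
  have h : (fun n => Num.sqrt (binomw x n k)) @ \oo --> Num.sqrt (poissonw x k).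
    apply: (@continuous_cvg _ _ _ _ _ _ Num.sqrt _ _ (@binomw_cvg x k x0)).
    exact: sqrt_continuous.
  by have := cvgB h (cvg_cst (Num.sqrt (poissonw x k))); rewrite subrr; apply.
have -> : (0 : R) = x ^+ k * (0 * 0) by rewrite !mulr0.
by apply: cvgM; [exact: cvg_cst|exact: (cvgM s0 s0)].
Unshelve. all: by end_near. Qed.

Lemma series_exp_coeff_le K : \sum_(0 <= k < K) exp_coeff x k <= expR x.
Proof.
apply: (@nondecreasing_cvgn_le _ (series (exp_coeff x))).
  apply/nondecreasing_seqP => n.
  by rewrite /series /= big_nat_recr//= lerDl exp_coeff_ge0.
exact: is_cvg_series_exp_coeff.
Qed.

Lemma trace_norm_spin_coh_cvg :
  (fun n => trace_norm (opsub
     (transport (spin_ketbra (spin_coh n (z / rc (Num.sqrt n%:R)))))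
     (ketbra (coh z)))) @ \oo --> (0 : R)%:E.
Proof.
apply: trace_norm_cvg0 => e e0.
have M0 : 0 < expR x + 1 by rewrite addr_gt0 ?expR_gt0.
(* Both vectors have squared norm at most [M = exp x], so an [l^2] distance at most [d] gives the
   trace norm bound [d (M + 1) = e]. *)
pose d := e / (expR x + 1); have d0 : 0 < d by rewrite divr_gt0.
have H : \forall n \near \oo, forall k,
    0 <= csq (spin_coh_fock n k - coh z k) <= exp_coeff x k.
  near=> n => k; rewrite csq_ge0 csq_spin_coh_sub_le//.
  by near: n; exact: near_gtn.
have := tannery0 H (is_cvg_series_exp_coeff x) csq_spin_coh_sub_cvg (exprn_gt0 2 d0).
move=> T; near=> n; rewrite transport_spin_ketbra.
have -> : e = d * (expR x + 1) by rewrite divfK// gt_eqF.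
have xn : x < n%:R by near: n; exact: near_gtn.
apply: trace_norm_ketbra_sub_le => // [K|K|].
- apply: le_trans (series_exp_coeff_le K); apply: ler_sum => k _.
  exact: csq_spin_coh_le.
- apply: le_trans (series_exp_coeff_le K); apply: ler_sum => k _.
  exact: csq_coh_le.
- by near: n.
Unshelve. all: by end_near. Qed.

End FixedPoint.
End CoherentLimit.

(** * Limits of traces of products of band operators *)

Section DefectLimit.
Variable R : realType.

Lemma fockw_sqr k : fockw R k * fockw R k = k.+1%:R.
Proof. by rewrite -expr2 sqr_sqrtr. Qed.

Lemma fockw_bound k : 0 <= fockw R k <= fockw R k.
Proof. by rewrite sqrtr_ge0 lexx. Qed.

(** Factor [sqrt (k+1)] out of both terms. For [k > n] the formula persists, as both [spinw] and the
    root on the right are then 0. *)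
Lemma defectwE n k : (0 < n)%N ->
  defectw R n k = fockw R k * (1 - Num.sqrt (1 - k%:R / n%:R)).
Proof.
move=> n0; have n1 : n%:R != 0 :> R by rewrite pnatr_eq0 -lt0n.
have -> : 1 - k%:R / n%:R = (n%:R)^-1 * (n%:R - k%:R) :> R by field.
rewrite /defectw /spinw sqrtrM// -/(fockw R k) sqrtrM ?invr_ge0// sqrtrV//.
by ring.
Qed.

Lemma defectw_bound n k : 0 <= defectw R n k <= fockw R k.
Proof.
have f0 : 0 <= fockw R k by rewrite sqrtr_ge0.
have [->|n0] := posnP n.
  (* At [n = 0] the inverse of 0 is 0, so the defect is the full Fock weight and the bound holds for
     every [n]. *)
  by rewrite /defectw sqrtr0 invr0 mul0r subr0 f0 lexx.
have s1 : Num.sqrt (1 - k%:R / n%:R) <= 1 :> R.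
  by rewrite -[leRHS]sqrtr1 ler_wsqrtr// gerBl divr_ge0.
by rewrite defectwE// mulr_ge0 ?subr_ge0//= ler_piMr// gerBl sqrtr_ge0.
Qed.

Lemma defectw_cvg k : (defectw R) ^~ k @ \oo --> (0 : R).
Proof.
have H : {near \oo, (fun n => fockw R k * (1 - Num.sqrt (1 - k%:R / n%:R)))
    =1 (defectw R) ^~ k}.
  by near=> n; rewrite defectwE//; near: n; exact: nbhs_infty_gt.
apply: cvg_trans (near_eq_cvg H) _.
have -> : (0 : R) = fockw R k * (1 - Num.sqrt 1) by rewrite sqrtr1 subrr mulr0.
apply: cvgM; first exact: cvg_cst.
apply: cvgB; first exact: cvg_cst.
apply: (@continuous_cvg _ _ _ _ _ _ Num.sqrt _ _ (@cvg_1subdivn R k%:R)).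
exact: sqrt_continuous.
Unshelve. all: by end_near. Qed.

Lemma shiftr_norm_bound (u : nat -> R) k :
  (forall k, `|u k| <= k.+1%:R) -> `|shiftr u k| <= k.+1%:R.
Proof.
case: k => [|k] h /=; first by rewrite normr0.
by rewrite (le_trans (h k))// ler_nat.
Qed.

Lemma mul_band_bound (u v : nat -> R) :
  (forall k, 0 <= u k <= fockw R k) -> (forall k, 0 <= v k <= fockw R k) ->
  forall k, `|u k * v k| <= k.+1%:R.
Proof.
move=> hu hv k; have /andP[u0 u1] := hu k; have /andP[v0 v1] := hv k.
by rewrite ger0_norm ?mulr_ge0// -fockw_sqr ler_pM.
Qed.

Lemma shiftr_cvg (u : nat -> nat -> R) (g : nat -> R) k :
  (forall k, u ^~ k @ \oo --> g k) ->
  (fun n => shiftr (u n) k) @ \oo --> shiftr g k.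
Proof. by case: k => [|k] h /=; [exact: cvg_cst|exact: h]. Qed.

(** Weights below [sqrt (k+1)] have products below [k + 1], and so do the shifted products; hence
    the linear growth bound with constant [|a| + |b|]. *)
Lemma trace_spin_band_cvg (p : R) (a b : R) (u v : nat -> nat -> R) (g : nat -> R)
    (Z : nat -> op R) (Z0 : op R) :
  0 < p -> p < 1 ->
  (forall n k, 0 <= u n k <= fockw R k) ->
  (forall n k, 0 <= v n k <= fockw R k) ->
  (forall k, (fun n => u n k * v n k) @ \oo --> g k) ->
  (forall n k, Z n k k =
     rc (a * (u n k * v n k) + b * shiftr (fun l => u n l * v n l) k)) ->
  (forall k, Z0 k k = rc (a * g k + b * shiftr g k)) ->
  (fun n => trace (opmul (transport (spin_state p n)) (Z n))) @ \oo -->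
  trace (opmul (thermal (p / (1 - p))) Z0).
Proof.
move=> p0 p1 hu hv uvg ZE Z0E.
apply: (trace_spin_cvg p0 p1 (c := `|a| + `|b|) _ _ ZE Z0E) => [n k|k].
  have uvb := mul_band_bound (hu n) (hv n).
  rewrite (le_trans (ler_normD _ _))// mulrDl
    (normrM a) (normrM b) lerD// ler_wpM2l//.
  exact: (shiftr_norm_bound k uvb).
apply: cvgD.
  by apply: cvgM; [exact: cvg_cst|exact: uvg].
apply: cvgM; [exact: cvg_cst|exact: (shiftr_cvg (u := fun n k => u n k * v n k))].
Qed.

(** Lets a limit 0 be read as the thermal expectation of the zero operator. *)
Lemma trace_opmul0 (X : op R) : trace (opmul X (fun _ _ => 0)) = 0.
Proof.
have X0 m n : opmul X (fun _ _ => 0) m n = 0.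
  by rewrite /opmul (@series_finite_cvg _ _ 0) ?big_nil// => k _; rewrite mulr0.
by rewrite /trace (@series_finite_cvg _ _ 0) ?big_nil// => k _.
Qed.

Lemma trace_spin_band_cvg0 (p : R) (a b : R) (u v : nat -> nat -> R)
    (Z : nat -> op R) :
  0 < p -> p < 1 ->
  (forall n k, 0 <= u n k <= fockw R k) ->
  (forall n k, 0 <= v n k <= fockw R k) ->
  (forall k, (fun n => u n k * v n k) @ \oo --> (0 : R)) ->
  (forall n k, Z n k k =
     rc (a * (u n k * v n k) + b * shiftr (fun l => u n l * v n l) k)) ->
  (fun n => trace (opmul (transport (spin_state p n)) (Z n))) @ \oo --> (0 : R[i]).
Proof.
move=> p0 p1 hu hv uv0 ZE; rewrite -(trace_opmul0 (thermal (p / (1 - p)))).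
apply: (trace_spin_band_cvg p0 p1 hu hv uv0 ZE) => k.
by case: k => [|k] /=; rewrite !mulr0 addr0 rc0.
Qed.

Lemma opmul_band_diag_rc (al be ga de : R[i]) (a b : R) (u v : nat -> R) k :
  al * de = rc a -> be * ga = rc b ->
  opmul (bandop al be u) (bandop ga de v) k k =
  rc (a * (u k * v k) + b * shiftr (fun l => u l * v l) k).
Proof. by move=> h1 h2; rewrite opmul_band_diag h1 h2 rcD !(rcM a) !(rcM b). Qed.

(** Exchanging the factors exchanges [al * de] with [be * ga], so symmetrising puts half their sum
    on both paths. Only this sum has to be real, not each product. *)
Lemma jordan_band_diag_rc (al be ga de : R[i]) (a : R) (u v : nat -> R) k :
  al * de + be * ga = rc a ->
  jordan (bandop al be u) (bandop ga de v) k k =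
  rc (a / 2 * (u k * v k) + a / 2 * shiftr (fun l => u l * v l) k).
Proof.
move=> h; rewrite /jordan /opscale /opadd !opmul_band_diag.
have -> : (fun l => v l * u l) = (fun l => u l * v l).
  by apply/funext => l; rewrite mulrC.
by rewrite (mulrC (v k)) rcD !(rcM (a / 2)) (rcM a) -h div1r; ring.
Qed.

Lemma sC_sqr : sC R * sC R = rc (1 / 2).
Proof. by rewrite /sC -rcM mulf_div mulr1 -expr2 sqr_sqrtr. Qed.

Lemma cC_sqr : cC R * cC R = - rc (1 / 2).
Proof.
have s2 : rc (Num.sqrt 2) * rc (Num.sqrt 2) = rc (2 : R).
  by rewrite -rcM -expr2 sqr_sqrtr.
have i2 : iC R * iC R = -1 by rewrite -expr2; exact: sqr_i.
by rewrite /cC -invfM mulrACA i2 s2 mulN1r invrN -rcV div1r.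
Qed.

End DefectLimit.

(** * The six limits *)

Unset Implicit Arguments.

(* j = n2/2 runs through the half-integers as n2 : nat runs through nat;
   j -> oo corresponds to n2 -> oo.  rho := W_j rho_{j,p} W_j^*, and
   1/sqrt(2j) = 1/sqrt n2, 1/sqrt j = 1/sqrt (n2/2). *)
Theorem mainTheorem6 (R : realType) (p : R) (hp0 : 0 < p) (hp1 : p < 1) :
  let N := p / (1 - p) in
  let rho := fun n2 : nat => transport (spin_state p n2) in
  let Jp := fun n2 : nat => transport (Jplus R n2) in
  let Jm := fun n2 : nat => transport (Jminus R n2) in
  let JJ1 := fun n2 : nat => transport (J1 R n2) in
  let JJ2 := fun n2 : nat => transport (J2 R n2) in
  let s2j := fun n2 : nat => rc (Num.sqrt (n2%:R : R)) in
  let sj := fun n2 : nat => rc (Num.sqrt (jval R n2)) in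
  let A := fun n2 : nat => opsub (ann R) (opscale (s2j n2)^-1 (Jp n2)) in
  let Ad := fun n2 : nat => opsub (cre R) (opscale (s2j n2)^-1 (Jm n2)) in
  let DQ := fun n2 : nat => opsub (Qop R) (opscale (sj n2)^-1 (JJ1 n2)) in
  let DP := fun n2 : nat => opsub (Pop R) (opscale (sj n2)^-1 (JJ2 n2)) in
  (* (1) *)
  ((fun n2 => trace_norm (opsub (rho n2) (thermal N))) @ \oo --> (0 : R)%:E) /\
  (* (2) *)
  (forall z : R[i],
     (fun n2 : nat => trace_norm
        (opsub (transport (spin_ketbra (spin_coh n2 (z / s2j n2))))
               (ketbra (coh z)))) @ \oo --> (0 : R)%:E) /\
  (* (3) *)
  ((fun n2 => trace (opmul (rho n2) (opmul (adj (A n2)) (A n2)))) @ \oo --> 0) /\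
  ((fun n2 => trace (opmul (rho n2) (opmul (adj (Ad n2)) (Ad n2)))) @ \oo --> 0) /\
  (* (4) *)
  ((fun n2 => trace (opmul (rho n2) (opmul (DQ n2) (DQ n2)))) @ \oo --> 0) /\
  ((fun n2 => trace (opmul (rho n2) (opmul (DP n2) (DP n2)))) @ \oo --> 0) /\
  (* (5) *)
  ((fun n2 => trace (opmul (rho n2) (opmul (Qop R) (Qop R)))) @ \oo -->
      trace (opmul (thermal N) (opmul (Qop R) (Qop R)))) /\
  ((fun n2 => trace (opmul (rho n2) (opmul (Pop R) (Pop R)))) @ \oo -->
      trace (opmul (thermal N) (opmul (Pop R) (Pop R)))) /\
  ((fun n2 => trace (opmul (rho n2) (jordan (Qop R) (Pop R)))) @ \oo -->
      trace (opmul (thermal N) (jordan (Qop R) (Pop R)))) /\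
  (* (6) *)
  (forall Y, (Y = (Qop R) \/ Y = (Pop R)) ->
     ((fun n2 => trace (opmul (rho n2) (jordan (DQ n2) Y))) @ \oo --> 0) /\
     ((fun n2 => trace (opmul (rho n2) (jordan (DP n2) Y))) @ \oo --> 0)).
Proof.
move=> N rho Jp Jm JJ1 JJ2 s2j sj A Ad DQ DP.
have fb (n k : nat) : 0 <= fockw R k <= fockw R k by exact: fockw_bound.
have db n k := defectw_bound R n k.
have dd k : (fun n => defectw R n k * defectw R n k) @ \oo --> (0 : R).
  by have := cvgM (@defectw_cvg R k) (@defectw_cvg R k); rewrite mulr0; apply.
have df k : (fun n => defectw R n k * fockw R k) @ \oo --> (0 : R).
  by have := cvgM (@defectw_cvg R k) (cvg_cst (fockw R k)); rewrite mul0r; apply.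
have ff k : (fun _ : nat => fockw R k * fockw R k) @ \oo --> fockw R k * fockw R k.
  exact: cvg_cst.
(* For fixed operators both weights are [fockw] for every [n], and only the state varies. *)
have static a Z := @trace_spin_band_cvg R p a a (fun=> fockw R) (fun=> fockw R)
  (fun k => fockw R k * fockw R k) (fun=> Z) Z hp0 hp1 fb fb ff.
have ss := sC_sqr R; have cc := cC_sqr R.
have cN : cC R * - cC R = rc (1 / 2) by rewrite mulrN cc opprK.
have Nc : - cC R * cC R = rc (1 / 2) by rewrite mulNr cc opprK.
have half2 : rc (1 / 2) + rc (1 / 2) = rc (1 : R) by rewrite -rcD -splitr.
have AE n : A n = bandop 1 0 (defectw R n) by exact: defect_annE.
have AdE n : Ad n = bandop 0 1 (defectw R n) by exact: defect_creE.
have DQE n : DQ n = bandop (sC R) (sC R) (defectw R n) by exact: defect_QE.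
have DPE n : DP n = bandop (cC R) (- cC R) (defectw R n) by exact: defect_PE.
split; first exact: trace_norm_spin_cvg.
split; first by move=> z; exact: trace_norm_spin_coh_cvg.
split.
  (* The adjoint of a lowering operator times the operator returns only through the lower level,
     hence [a = 0], [b = 1]; for the raising operator the roles are swapped. *)
  apply: (trace_spin_band_cvg0 (a := 0) (b := 1) hp0 hp1 db db dd) => n k.
  rewrite AE adj_band conjc0 conjc1.
  by apply: opmul_band_diag_rc; rewrite ?mul0r ?mulr1 ?rc0 ?rc1.
split.
  apply: (trace_spin_band_cvg0 (a := 1) (b := 0) hp0 hp1 db db dd) => n k.
  rewrite AdE adj_band conjc0 conjc1.
  by apply: opmul_band_diag_rc; rewrite ?mul0r ?mulr1 ?rc0 ?rc1.
split.
  apply: (trace_spin_band_cvg0 (a := 1 / 2) (b := 1 / 2) hp0 hp1 db db dd) => n k.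
  by rewrite DQE; apply: opmul_band_diag_rc.
split.
  apply: (trace_spin_band_cvg0 (a := 1 / 2) (b := 1 / 2) hp0 hp1 db db dd) => n k.
  by rewrite DPE; apply: opmul_band_diag_rc.
split.
  rewrite QopE.
  apply: (static (1 / 2)) => *; exact: opmul_band_diag_rc.
split.
  rewrite PopE.
  apply: (static (1 / 2)) => *; exact: opmul_band_diag_rc.
(* The Jordan coefficient cancels for the mixed pairs, so those diagonals vanish identically, and
   equals 1 for matching pairs. The constants [0 / 2] and [1 / 2] below are its halves. *)
have QP0 : sC R * - cC R + sC R * cC R = rc 0 by rewrite mulrN addNr.
have PQ0 : cC R * sC R + - cC R * sC R = rc 0 by rewrite mulNr subrr.
have QQ1 : sC R * sC R + sC R * sC R = rc 1 by rewrite ss.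
have PP1 : cC R * - cC R + - cC R * cC R = rc 1 by rewrite cN Nc.
split.
  rewrite QopE PopE.
  apply: (static (0 / 2)) => *; exact: jordan_band_diag_rc.
move=> Y [->|->]; rewrite ?QopE ?PopE; split.
- apply: (trace_spin_band_cvg0 (a := 1 / 2) (b := 1 / 2)
    (v := fun=> fockw R) hp0 hp1 db fb df) => n k.
  by rewrite DQE; apply: jordan_band_diag_rc.
- apply: (trace_spin_band_cvg0 (a := 0 / 2) (b := 0 / 2)
    (v := fun=> fockw R) hp0 hp1 db fb df) => n k.
  by rewrite DPE; apply: jordan_band_diag_rc.
- apply: (trace_spin_band_cvg0 (a := 0 / 2) (b := 0 / 2)
    (v := fun=> fockw R) hp0 hp1 db fb df) => n k.
  by rewrite DQE; apply: jordan_band_diag_rc.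
- apply: (trace_spin_band_cvg0 (a := 1 / 2) (b := 1 / 2)
    (v := fun=> fockw R) hp0 hp1 db fb df) => n k.
  by rewrite DPE; apply: jordan_band_diag_rc.
Qed.
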